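(* Let $\Pi$ be a ground program and let $A$ be an $\mathcal{A}log$ answer set of $\Pi$ or an $\mathcal{S}log^+$ answer set of $\Pi$. Then: 1. $A$ satisfies every rule $r$ of $\Pi$. 2. If $p(\bar t)\in A$, then there is a rule $r$ of $\Pi$ such that the body of $r$ is satisfied by $A$ and either (a) $p(\bar t)$ is the only atom in the head of $r$ which is true in $A$, or (b) the head of $r$ is of the form $p\subseteq\{\bar X:q(\bar X)\}$ or $p=\{\bar X:q(\bar X)\}$ and $q(\bar t)$ holds in $A$ (i.e. $q(\bar t)\in A$ when the condition $q(\bar X)$ is a single literal, and in general all literals of the condition instantiated by $\bar t$ belong to $A$).
   Context: **Syntax (common to $\mathcal{A}log$ and $\mathcal{S}log^+$).** Let $\Sigma$ be a signature with finitely many predicate and function symbols and a possibly infinite collection of object constants. Let $\mathcal{F}$ be a finite collection of symbols denoting (possibly partial) functions from sets of (tuples of) ground terms of $\Sigma$ into integers (e.g. $card$, which is undefined on infinite sets, and $min$). Terms, atoms $p(\bar t)$ and literals ($p(\bar t)$ or its classical negation $\neg p(\bar t)$) over $\Sigma$ are called regular; they are ground if they contain no variables and no arithmetic function symbols. A set name is an expression $\{\bar X:cond\}$ where $cond$ is a finite collection of regular literals and $\bar X$ is the list of variables occurring in $cond$; $cond(\bar t)$ denotes the set of ground literals obtained by substituting ground terms $\bar t$ for $\bar X$. A set atom is an expression of the form $f_1(S_1)\odot f_2(S_2)$, $f(S)\odot k$, or $S_1\otimes S_2$, where $f,f_1,f_2\in\mathcal{F}$, $S,S_1,S_2$ are set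 names, $k$ is a number, $\odot\in\{>,\ge,<,\le,=,\ne\}$ and $\otimes\in\{\subset,\subseteq,=\}$. In set atoms, a predicate symbol $p$ used as a set abbreviates $\{\bar X:p(\bar X)\}$. A rule is an expression $head\leftarrow body$, where $head$ is a (possibly empty, possibly infinite) disjunction of regular literals or a set atom of the form $p\subseteq S$, $S\subseteq p$ or $p=S$ ($p$ a predicate symbol, $S$ a set name), and $body$ is a (possibly empty, possibly infinite) collection of regular literals, possibly preceded by default negation $not$, and set atoms. A rule with a set atom in the head is a set introduction rule. A program is a collection of rules. All variables are bound in set names (rules with other variables are shorthand for their ground instantiations), so programs are ground. **Satisfaction.** Let $A$ be a set of ground regular literals. A regular literal $l$ is true in $A$ iff $l\in A$; $not\ l$ is true iff $l\notin A$. A disjunction is true iff one of its literals is in $A$ (the empty head is never true). A set atom is evaluated in $A$ by interpreting each set name $\{\bar X:cond\}$ as the set $\{\bar t: cond(\bar t)\subseteq A\}$: it is undefined in $A$ if some function in it is undefined on the corresponding set; otherwise it is true or false according to the resulting (in)equality or set relation. A body is satisfied by $A$ if all its elements are true in $A$. A rule is satisfied by $A$ if its head is true in $A$ or its body is false or undefined in $A$ (i.e. not all elements of the body are true). **Answer sets of programs without set atoms.** If a program contains neither $not$ nor set atoms, its answer sets are the subset-minimal consistent sets of ground literals satisfying all its rules. For a program $\Pi$ with $not$ but no set atoms, $A$ is an answer set of $\Pi$ iff $A$ is an answer set of the program obtained from $\Pi$ by deleting each rule containing $not\ l$ with $l\in A$ and deleting all remaining expressions $not\ l$. Rules may be infinite.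 **$\mathcal{A}log$ set reduct.** For $\Pi$ without set atoms in heads, the $\mathcal{A}log$ set reduct of $\Pi$ with respect to $A$ is obtained by (1) removing rules containing set atoms that are false or undefined in $A$; (2) replacing every remaining set atom $SA$ by the union of all $cond(\bar t)$ such that $\{\bar X:cond(\bar X)\}$ occurs in $SA$ and $cond(\bar t)\subseteq A$. **Minimal support.** For vectors $\bar W=(W_1,\dots,W_n)$, $\bar V=(V_1,\dots,V_n)$ of sets of ground regular literals, $\bar W\le\bar V$ means $W_i\subseteq V_i$ for all $i$, and $\bar W<\bar V$ means $\bar W\le\bar V$ and $\bar W\ne\bar V$. A set atom $C(\{\bar X:cond_1\},\dots,\{\bar X:cond_n\})$ with $n$ set names is satisfied by $\bar W$ if $C(\{\bar t:cond_1(\bar t)\subseteq W_1\},\dots,\{\bar t:cond_n(\bar t)\subseteq W_n\})$ is true. $\bar W$ is a minimal support for $C$ in $A$ if: (i) $W_i\subseteq A$ for every $i$; (ii) every $\bar V$ with $W_i\subseteq V_i\subseteq A$ for all $i$ satisfies $C$; (iii) no $\bar U<\bar W$ satisfies (i) and (ii). **$\mathcal{S}log^+$ set reduct.** For $\Pi$ without set atoms in heads, an $\mathcal{S}log^+$ set reduct of $\Pi$ with respect to $A$ is any program obtained by (1) removing rules containing set atoms that are false or undefined in $A$; (2) replacing every remaining set atom occurrence $C$ in the body of a rule by the union of the coordinates of one of its minimal supports in $A$ (choices made independently, so there may be several set reducts). **Answer sets, no set atoms in heads.** $A$ is an $\mathcal{A}log$ answer set of $\Pi$ iff $A$ is an answer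 set of the $\mathcal{A}log$ set reduct of $\Pi$ with respect to $A$. $A$ is an $\mathcal{S}log^+$ answer set of $\Pi$ iff $A$ is an answer set of some $\mathcal{S}log^+$ set reduct of $\Pi$ with respect to $A$. **Set introduction reduct and general case.** The set introduction reduct of $\Pi$ with respect to $A$ is obtained by (1) replacing every set introduction rule whose head is not true in $A$ by $\leftarrow body$; (2) replacing every set introduction rule whose head $p\subseteq S$, $p=S$ or $S\subseteq p$ is true in $A$ by the rules $p(\bar t)\leftarrow body$ for each $p(\bar t)\in A$. For an arbitrary program $\Pi$, $A$ is an $\mathcal{A}log$ (respectively $\mathcal{S}log^+$) answer set of $\Pi$ iff it is an $\mathcal{A}log$ (respectively $\mathcal{S}log^+$) answer set of the set introduction reduct of $\Pi$ with respect to $A$.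
   Formalization: Part 2 gets a third alternative (c): the head of r is of the form S ⊆ p. Without it the claim fails: for the program { {X:q(X)} ⊆ p ← }, the set A = {p(a)} is an answer set, but neither (a) nor (b) holds. *)

(* Defs.v *)
From Stdlib Require List.
From mathcomp Require Import all_boot all_order all_algebra.
From mathcomp Require Import boolp classical_sets functions cardinality.

Set Implicit Arguments.
Unset Strict Implicit.
Unset Printing Implicit Defensive.

Local Open Scope classical_set_scope.

Record signature := Signature {
  pred_sym : finType;
  pred_ar : pred_sym -> nat;
  fun_sym : finType;
  fun_ar : fun_sym -> nat;
  arith : {pred fun_sym};  (* the arithmetic function symbols *)
  const : Type }.

Inductive term (Sg : signature) : Type :=
| Var of nat
| Cst of const Sg
| App (f : fun_sym Sg) of {ffun 'I_(fun_ar f) -> term Sg}.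

Arguments Var {Sg}.
Arguments Cst {Sg}.
Arguments App {Sg} f.

Fixpoint ground_term (Sg : signature) (t : term Sg) : Prop :=
  match t with
  | Var _ => False
  | Cst _ => True
  | App f args => f \notin @arith Sg /\ forall i, ground_term (args i)
  end.

Fixpoint occurs_term (Sg : signature) (x : nat) (t : term Sg) : Prop :=
  match t with
  | Var y => x = y
  | Cst _ => False
  | App f args => exists i, occurs_term x (args i)
  end.

Fixpoint subst_term (Sg : signature) (s : nat -> term Sg) (t : term Sg) :
    term Sg :=
  match t with
  | Var x => s x
  | Cst c => Cst c
  | App f args => App f (finfun (fun i => subst_term s (args i)))
  end.

(* The value of f on a set of tuples of ground terms; None = undefined.
   Tuples are lists because set names have varying numbers of variables. *)
Record language := Language {
  lang_sig :> signature;
  set_fun : finType;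
  set_fun_val : set_fun -> set (seq (term lang_sig)) -> option int }.

Inductive literal (Sg : signature) : Type :=
| Pos (p : pred_sym Sg) of (pred_ar p).-tuple (term Sg)
| Neg (p : pred_sym Sg) of (pred_ar p).-tuple (term Sg).

Arguments Pos {Sg} p.
Arguments Neg {Sg} p.

Definition lit_args (Sg : signature) (l : literal Sg) : seq (term Sg) :=
  match l with Pos _ ts => ts | Neg _ ts => ts end.

Definition ground_lit (Sg : signature) (l : literal Sg) : Prop :=
  forall t, List.In t (lit_args l) -> ground_term t.

Definition occurs_lit (Sg : signature) (x : nat) (l : literal Sg) : Prop :=
  exists t, List.In t (lit_args l) /\ occurs_term x t.

Definition subst_lit (Sg : signature) (s : nat -> term Sg) (l : literal Sg) :
    literal Sg :=
  match l with
  | Pos p ts => Pos p (map_tuple (subst_term s) ts)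
  | Neg p ts => Neg p (map_tuple (subst_term s) ts)
  end.

Definition ground_set (Sg : signature) (A : set (literal Sg)) : Prop :=
  A `<=` @ground_lit Sg.

Definition consistent (Sg : signature) (A : set (literal Sg)) : Prop :=
  forall p ts, ~ (A (Pos p ts) /\ A (Neg p ts)).

Record set_name (Sg : signature) := SetName {
  svars : seq nat;
  scond : set (literal Sg) }.

Definition wf_set_name (Sg : signature) (S : set_name Sg) : Prop :=
  [/\ finite_set (scond S), uniq (svars S) &
      forall x, x \in svars S <-> exists l, scond S l /\ occurs_lit x l].

(* cond(t), for a tuple t of the same length as the list of variables *)
Definition inst (Sg : signature) (S : set_name Sg) (t : seq (term Sg)) :
    set (literal Sg) :=
  subst_lit (fun x => nth (Var x) t (index x (svars S))) @` scond S.

(* If cond contains arithmetic symbols then so does cond(t), and cond(t) is not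
   included in a set A of ground literals. *)
Definition ext (Sg : signature) (S : set_name Sg) (A : set (literal Sg)) :
    set (seq (term Sg)) :=
  [set t | [/\ size t = size (svars S),
               forall u, List.In u t -> ground_term u &
               inst S t `<=` A]].

Definition psym_set (Sg : signature) (p : pred_sym Sg) : set_name Sg :=
  SetName (iota 0 (pred_ar p))
          [set Pos p (mktuple (fun i : 'I_(pred_ar p) => Var i))].

Inductive cmp := CGt | CGe | CLt | CLe | CEq | CNe.

Definition cmp_val (o : cmp) (x y : int) : bool :=
  match o with
  | CGt => (x > y)%R
  | CGe => (x >= y)%R
  | CLt => (x < y)%R
  | CLe => (x <= y)%R
  | CEq => x == y
  | CNe => x != y
  end.

Inductive set_rel := RProper | RSub | REq.

Definition set_rel_val (T : Type) (r : set_rel) (X Y : set T) : bool :=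
  match r with
  | RProper => `[< X `<` Y >]
  | RSub => `[< X `<=` Y >]
  | REq => `[< X = Y >]
  end.

Inductive set_atom (L : language) : Type :=
| FunFun (f1 : set_fun L) (S1 : set_name L) (o : cmp)
         (f2 : set_fun L) (S2 : set_name L)
| FunNum (f : set_fun L) (S : set_name L) (o : cmp) (k : int)
| SetSet (S1 : set_name L) (r : set_rel) (S2 : set_name L).

Arguments FunFun {L}.
Arguments FunNum {L}.
Arguments SetSet {L}.

Definition nsets (L : language) (C : set_atom L) : nat :=
  match C with FunNum _ _ _ _ => 1 | _ => 2 end.

Definition name_of (L : language) (C : set_atom L) : 'I_(nsets C) -> set_name L :=
  match C return 'I_(nsets C) -> set_name L with
  | FunFun _ S1 _ _ S2 => fun i => if val i == 0 then S1 else S2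
  | FunNum _ N _ _ => fun=> N
  | SetSet S1 _ S2 => fun i => if val i == 0 then S1 else S2
  end.

(* C(D_1, ..., D_n); None = undefined *)
Definition eval (L : language) (C : set_atom L) :
    ('I_(nsets C) -> set (seq (term L))) -> option bool :=
  match C return ('I_(nsets C) -> set (seq (term L))) -> option bool with
  | FunFun f1 _ o f2 _ => fun D =>
      match set_fun_val f1 (D ord0), set_fun_val f2 (D ord_max) with
      | Some x, Some y => Some (cmp_val o x y)
      | _, _ => None
      end
  | FunNum f _ o k => fun D =>
      match set_fun_val f (D ord0) with
      | Some x => Some (cmp_val o x k)
      | None => None
      end
  | SetSet _ r _ => fun D => Some (set_rel_val r (D ord0) (D ord_max))
  end.

Definition satisfied_by (L : language) (C : set_atom L)
    (W : 'I_(nsets C) -> set (literal L)) : Prop :=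
  eval (fun i => ext (name_of i) (W i)) = Some true.

Definition set_atom_true (L : language) (A : set (literal L)) (C : set_atom L) :
    Prop :=
  satisfied_by (fun _ : 'I_(nsets C) => A).

(* SubHead p S, SupHead S p, EqHead p S: the heads p <= S, S <= p, p = S *)
Inductive rule_head (L : language) : Type :=
| Disj of set (literal L)
| SubHead of pred_sym L & set_name L
| SupHead of set_name L & pred_sym L
| EqHead of pred_sym L & set_name L.

Arguments Disj {L}.
Arguments SubHead {L}.
Arguments SupHead {L}.
Arguments EqHead {L}.

Inductive body_elt (L : language) : Type :=
| BLit of literal L
| BNot of literal L
| BSet of set_atom L.

Arguments BLit {L}.
Arguments BNot {L}.
Arguments BSet {L}.

Record rule (L : language) := Rule {
  rhead : rule_head L;
  rbody : set (body_elt L) }.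

Definition program (L : language) := set (rule L).

Definition wf_set_atom (L : language) (C : set_atom L) : Prop :=
  forall i : 'I_(nsets C), wf_set_name (name_of i).

Definition ground_head (L : language) (h : rule_head L) : Prop :=
  match h with
  | Disj H => ground_set H
  | SubHead _ N => wf_set_name N
  | SupHead N _ => wf_set_name N
  | EqHead _ N => wf_set_name N
  end.

Definition ground_body_elt (L : language) (e : body_elt L) : Prop :=
  match e with
  | BLit l => ground_lit l
  | BNot l => ground_lit l
  | BSet C => wf_set_atom C
  end.

Definition ground_program (L : language) (Pi : program L) : Prop :=
  forall r, Pi r ->
    ground_head (rhead r) /\ forall e, rbody r e -> ground_body_elt e.

Definition head_true (L : language) (A : set (literal L)) (h : rule_head L) :
    Prop :=
  match h with
  | Disj H => exists l, H l /\ A l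
  | SubHead p N => set_atom_true A (SetSet (psym_set p) RSub N)
  | SupHead N p => set_atom_true A (SetSet N RSub (psym_set p))
  | EqHead p N => set_atom_true A (SetSet (psym_set p) REq N)
  end.

Definition body_elt_true (L : language) (A : set (literal L)) (e : body_elt L) :
    Prop :=
  match e with
  | BLit l => A l
  | BNot l => ~ A l
  | BSet C => set_atom_true A C
  end.

Definition body_sat (L : language) (A : set (literal L)) (B : set (body_elt L)) :
    Prop :=
  forall e, B e -> body_elt_true A e.

Definition rule_sat (L : language) (A : set (literal L)) (r : rule L) : Prop :=
  head_true A (rhead r) \/ ~ body_sat A (rbody r).

Definition program_sat (L : language) (A : set (literal L)) (Pi : program L) :
    Prop :=
  forall r, Pi r -> rule_sat A r.

(* programs with neither default negation nor set atoms *)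
Definition basic_answer_set (L : language) (Pi : program L)
    (A : set (literal L)) : Prop :=
  [/\ ground_set A, consistent A, program_sat A Pi &
      forall B, ground_set B -> consistent B -> program_sat B Pi ->
        B `<=` A -> B = A].

Definition not_reduct (L : language) (Pi : program L) (A : set (literal L)) :
    program L :=
  [set r' | exists r, [/\ Pi r,
     forall l, rbody r (BNot l) -> ~ A l &
     r' = Rule (rhead r) [set e | rbody r e /\ forall l, e <> BNot l]]].

(* programs without set atoms *)
Definition answer_set (L : language) (Pi : program L) (A : set (literal L)) :
    Prop :=
  basic_answer_set (not_reduct Pi A) A.

Definition replace_set_atoms (L : language) (U : set_atom L -> set (literal L))
    (r : rule L) : rule L :=
  Rule (rhead r)
       ([set e | rbody r e /\ forall C, e <> BSet C] `|`
        [set e | exists C l, [/\ rbody r (BSet C), U C l & e = BLit l]]).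

Definition set_atoms_true (L : language) (A : set (literal L)) (r : rule L) :
    Prop :=
  forall C, rbody r (BSet C) -> set_atom_true A C.

Definition alog_support (L : language) (A : set (literal L)) (C : set_atom L) :
    set (literal L) :=
  [set l | exists (i : 'I_(nsets C)) t,
     ext (name_of i) A t /\ inst (name_of i) t l].

(* programs without set atoms in heads *)
Definition alog_set_reduct (L : language) (Pi : program L)
    (A : set (literal L)) : program L :=
  [set r' | exists r, [/\ Pi r, set_atoms_true A r &
     r' = replace_set_atoms (alog_support A) r]].

Definition pre_support (L : language) (A : set (literal L)) (C : set_atom L)
    (W : 'I_(nsets C) -> set (literal L)) : Prop :=
  (forall i, W i `<=` A) /\
  (forall V : 'I_(nsets C) -> set (literal L),
     (forall i, W i `<=` V i /\ V i `<=` A) -> satisfied_by V).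

Definition minimal_support (L : language) (A : set (literal L)) (C : set_atom L)
    (W : 'I_(nsets C) -> set (literal L)) : Prop :=
  pre_support A W /\
  forall U : 'I_(nsets C) -> set (literal L),
    (forall i, U i `<=` W i) -> U <> W -> ~ pre_support A U.

(* ch r C is the minimal support chosen for the occurrence of C in r; if some
   set atom to be replaced has no minimal support, there is no set reduct. *)
Definition is_slogp_set_reduct (L : language) (Pi : program L)
    (A : set (literal L)) (Pi' : program L) : Prop :=
  exists ch : rule L -> forall C : set_atom L, 'I_(nsets C) -> set (literal L),
    (forall r C, Pi r -> set_atoms_true A r -> rbody r (BSet C) ->
       minimal_support A (ch r C)) /\
    Pi' = [set r' | exists r, [/\ Pi r, set_atoms_true A r &
             r' = replace_set_atoms (fun C => \bigcup_i ch r C i) r]].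

(* A rule with head S <= p true in A contributes p(t) <- body for every p(t) in
   A, including those with t outside S. *)
Definition set_intro_reduct (L : language) (Pi : program L)
    (A : set (literal L)) : program L :=
  [set r' | exists r, Pi r /\
     let replaced (p : pred_sym L) :=
       (~ head_true A (rhead r) /\ r' = Rule (Disj set0) (rbody r)) \/
       (head_true A (rhead r) /\ exists ts : (pred_ar p).-tuple (term L),
          A (Pos p ts) /\ r' = Rule (Disj [set Pos p ts]) (rbody r)) in
     match rhead r with
     | Disj _ => r' = r
     | SubHead p _ => replaced p
     | SupHead _ p => replaced p
     | EqHead p _ => replaced p
     end].

Definition alog_answer_set (L : language) (Pi : program L)
    (A : set (literal L)) : Prop :=
  answer_set (alog_set_reduct (set_intro_reduct Pi A) A) A.

Definition slogp_answer_set (L : language) (Pi : program L)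
    (A : set (literal L)) : Prop :=
  exists Pi', is_slogp_set_reduct (set_intro_reduct Pi A) A Pi' /\
    answer_set Pi' A.

(* Main.v *)
Require Import Defs.
From mathcomp Require Import all_boot all_order all_algebra.
From mathcomp Require Import boolp classical_sets functions cardinality.

(* All the set reducts replace each set atom true in A by some set of literals of
   A, and this alone gives both claims.  A rule whose body is true in A then keeps
   a reduct whose body is true in A, so its head is true in A.  Conversely, if no
   rule with body true in A has p(t) as its only true head literal, then A without
   p(t) still satisfies the reduct, against the minimality of A. *)

Set Implicit Arguments.
Unset Strict Implicit.
Unset Printing Implicit Defensive.

Local Open Scope classical_set_scope.

Section Reduct.
Variables (L : language) (A : set (literal L)).

(** A common form for both kinds of set reduct. The replacement depends on the rule as well as on
    the set atom, since the minimal supports are chosen separately in each rule. *)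
Definition set_reduct (U : rule L -> set_atom L -> set (literal L))
    (Pi : program L) : program L :=
  [set r' | exists r, [/\ Pi r, set_atoms_true A r &
     r' = replace_set_atoms (U r) r]].

Definition support_choice (U : rule L -> set_atom L -> set (literal L))
    (Pi : program L) : Prop :=
  forall r C, Pi r -> set_atoms_true A r -> rbody r (BSet C) -> U r C `<=` A.

Lemma alog_support_sub (C : set_atom L) : alog_support A C `<=` A.
Proof. by move=> l [i [t [[_ _ tA] tl]]]; exact: tA. Qed.

Lemma set_reduct_of_answer_set (Pi : program L) :
  alog_answer_set Pi A \/ slogp_answer_set Pi A ->
  exists2 U, support_choice U (set_intro_reduct Pi A) &
    answer_set (set_reduct U (set_intro_reduct Pi A)) A.
Proof.
case=> [Aalog|[_ [[ch [chmin ->]] Aans]]].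
  by exists (fun=> alog_support A) => // r C _ _ _; exact: alog_support_sub.
exists (fun r C => \bigcup_i ch r C i) => // r C Pir rA rC l [i _ li].
by have [[chA _] _] := chmin r C Pir rA rC; exact: chA li.
Qed.

Lemma body_sat_set_atoms_true (r : rule L) :
  body_sat A (rbody r) -> set_atoms_true A r.
Proof. by move=> rA C /rA. Qed.

Lemma answer_set_head_true U (Pi : program L) (r : rule L) :
  support_choice U Pi -> answer_set (set_reduct U Pi) A ->
  Pi r -> body_sat A (rbody r) -> head_true A (rhead r).
Proof.
move=> UA [_ _ Asat _] Pir rA; have satA := body_sat_set_atoms_true rA.
pose r1 := replace_set_atoms (U r) r.
have r1A : body_sat A (rbody r1).
  move=> e [[re _]|[C [l [rC Ul ->]]]]; first exact: rA.
  exact: UA rC _ Ul.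
(* The rule [r1] survives [not_reduct]: [r1A] at [BNot l] says exactly that [l] is not in [A]. *)
have [//|[]] := Asat (Rule (rhead r1) [set e | rbody r1 e /\ forall l, e <> BNot l])
  (ex_intro _ r1 (And3 (ex_intro _ r (And3 Pir satA erefl))
                       (fun l => r1A (BNot l)) erefl)).
by move=> e [/r1A].
Qed.

Lemma answer_set_supported U (Pi : program L) (a : literal L) :
  (forall r, Pi r -> exists H, rhead r = Disj H) ->
  support_choice U Pi -> answer_set (set_reduct U Pi) A -> A a ->
  exists r H, [/\ Pi r, body_sat A (rbody r), rhead r = Disj H, H a &
                  forall l, H l -> A l -> l = a].
Proof.
move=> disjPi UA Aans Aa; apply: contrapT => nosupp.
have [Agr Acons _ Amin] := Aans.
have DA : A `\ a `<=` A by move=> l [].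
(* Minimality would then give [A] without [a] equal to [A], although [a] is in [A]. *)
suff /Amin /(_ DA) AaE : program_sat (A `\ a) (not_reduct (set_reduct U Pi) A).
  have : (A `\ a) a by rewrite AaE //; [exact: subset_trans Agr
    |move=> p ts [/DA ? /DA ?]; exact: (Acons p ts)].
  by case=> _; exact.
move=> _ [_ [[r [Pir rset ->]] rnot ->]].
rewrite /rule_sat /= orpN => rB.
(* Literals pass from the smaller set up to [A]; default negations and set atoms are true in [A]
   because both reducts kept the rule. *)
have rA : body_sat A (rbody r).
  case=> [l|l|C] re; last exact: rset.
    by apply: DA; apply: (rB (BLit l)); split=> //; left; split.
  by apply: rnot; left; split.
have [H rH] := disjPi r Pir.
have := answer_set_head_true UA Aans Pir rA; rewrite rH /= => -[l [Hl Al]].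
(* If no head literal is true in [A] without [a], then [a] is the only one true in [A], and [r]
   contradicts [nosupp]. *)
apply: contrapT => noB; apply: nosupp; exists r, H.
have Honly k : H k -> A k -> k = a.
  by move=> Hk Ak; apply: contrapT => ka; apply: noB; exists k.
by split=> //; rewrite -(Honly l).
Qed.

Lemma set_intro_reduct_disj (Pi : program L) (r : rule L) :
  set_intro_reduct Pi A r -> exists H, rhead r = Disj H.
Proof.
case=> r0 [_]; case E: (rhead r0) => [H|p N|N p|p N] /=.
- by move=> ->; exists H.
- by case=> [[_ ->]|[_ [ts [_ ->]]]]; eexists.
- by case=> [[_ ->]|[_ [ts [_ ->]]]]; eexists.
- by case=> [[_ ->]|[_ [ts [_ ->]]]]; eexists.
Qed.

(** Turns an atom of [A] into a member of the left-hand side of a head [p <= S] or [p = S].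
    Groundness of [A] is what makes the tuple admissible in [ext]. *)
Lemma ext_psym_set (p : pred_sym L) (ts : (pred_ar p).-tuple (term L)) :
  ground_set A -> A (Pos p ts) -> ext (psym_set p) A ts.
Proof.
move=> Agr Ats; split; first by rewrite size_tuple size_iota.
  exact: (Agr _ Ats).
move=> _ [_ -> <-] /=.
suff -> : map_tuple (subst_term (fun x => nth (Var x) ts
    (index x (iota 0 (pred_ar p))))) (mktuple (fun i : 'I_(pred_ar p) => Var i))
    = ts by [].
apply: eq_from_tnth => i; rewrite tnth_map tnth_mktuple /=.
(* The variables of [psym_set p] are numbered by their positions, so substituting [ts] gives back
   [ts]. *)
suff -> : index (i : nat) (iota 0 (pred_ar p)) = i by rewrite -tnth_nth.
rewrite -[X in index X]add0n -(nth_iota 0 0 (ltn_ord i)).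
by rewrite index_uniq ?size_iota ?iota_uniq.
Qed.

End Reduct.

Theorem proposition1 (L : language) (Pi : program L) (A : set (literal L)) :
  ground_program Pi ->
  alog_answer_set Pi A \/ slogp_answer_set Pi A ->
  (forall r : rule L, Pi r -> rule_sat A r) /\
  (forall (p : pred_sym L) (ts : (pred_ar p).-tuple (term L)),
     A (Pos p ts) ->
     exists r : rule L,
       [/\ Pi r, body_sat A (rbody r) &
           [\/ (exists H : set (literal L),
                  [/\ rhead r = Disj H, H (Pos p ts) &
                      forall l : literal L, H l -> A l -> l = Pos p ts]),
               (exists S : set_name L,
                  (rhead r = SubHead p S \/ rhead r = EqHead p S) /\
                  ext S A (tval ts)) |
               (exists S : set_name L, rhead r = SupHead S p)]]).
Proof.
move=> _ /set_reduct_of_answer_set [U UA Aans].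
have [Agr _ _ _] := Aans; split.
  move=> r Pir; rewrite /rule_sat orpN => rA.
  apply: contrapT => rF.
  (* A set introduction rule with false head would leave a constraint in the reduct, and its body is
     true in [A]. *)
  have cons_red : set_intro_reduct Pi A (Rule (Disj set0) (rbody r)) -> False.
    by move=> /(answer_set_head_true UA Aans) /(_ rA) [l []].
  case E: (rhead r) => [H|p N|N p|p N];
    try by apply: cons_red; exists r; rewrite E; split=> //; left; rewrite -E.
  apply/rF/(answer_set_head_true UA Aans) => //.
  by exists r; rewrite E.
move=> p ts Ats.
have [r' [H [[r [Pir rr']] r'A r'H Hts Honly]]] :=
  answer_set_supported (@set_intro_reduct_disj _ _ Pi) UA Aans Ats.
exists r; case E: (rhead r) rr' => [H0|q N|N q|q N] /=.
- move=> r'r; subst r'; split=> //; apply: Or31; exists H.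
  by rewrite -E r'H.
(* The supporting rule is not a constraint, since its head contains p(t); so it is q(u) <- body with
   q(u) = p(t). *)
all: case=> [[_ r'E]|[rA [us [_ r'E]]]];
  move: r'A r'H Hts; rewrite r'E /= => r'A [<-] // [qp _]; subst q; split=> //.
- apply: Or32; exists N; split; first by left.
  by move: rA => [] /asboolP; apply; exact: ext_psym_set.
(* A true head [S <= p] introduces every p(t) of [A], even for t outside [S], so nothing is claimed
   about t here. *)
- by apply: Or33; exists N.
- apply: Or32; exists N; split; first by right.
  by move: rA => [] /asboolP <-; exact: ext_psym_set.
Qed.
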